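(* Let $\&$ be a continuous t-norm on $[0,1]$. If $X$ is a separated and injective $[0,1]$-approach space, then its specialization $[0,1]$-ordered set $\Omega(X)$ is a continuous $[0,1]$-lattice and $X=\Sigma\Omega(X)$; that is, the $[0,1]$-approach structure of $X$ coincides with the Scott $[0,1]$-approach structure of $\Omega(X)$.
   Context: A continuous t-norm is a continuous map $\&:[0,1]^2\to[0,1]$, monotone in each variable, making $([0,1],\&,1)$ a commutative monoid. Its implication is $x\to y=\sup\{z\mid x\& z\le y\}$, so $x\& z\le y\iff z\le x\to y$. A $[0,1]$-order on a set $X$ is a map $X(-,-):X\times X\to[0,1]$ with $X(x,x)=1$ and $X(y,z)\& X(x,y)\le X(x,z)$ for all $x,y,z$. It is separated if $X(x,y)=X(y,x)=1$ implies $x=y$. A weight of $X$ is a map $\phi:X\to[0,1]$ with $\phi(y)\& X(x,y)\le\phi(x)$ for all $x,y$. For maps $\phi,\psi:X\to[0,1]$ put $\mathrm{sub}_X(\phi,\psi)=\inf_{x\in X}(\phi(x)\to\psi(x))$. An element $a$ of $X$ is a supremum of a weight $\phi$, written $a=\sup\phi$, if $X(a,y)=\mathrm{sub}_X(\phi,X(-,y))$ for all $y\in X$. $X$ is a complete $[0,1]$-lattice if it is separated and every weight of $X$ has a supremum. A net $\{x_i\}_i$ (indexed by a non-empty directed set) in $X$ is forward Cauchy if $\sup_i\inf_{i\le j\le l}X(x_j,x_l)=1$; a weight is forward Cauchy if it has the form $\sup_i\inf_{j\ge i}X(-,x_j)$ for some forward Cauchy net. $\mathcal{D}X$ is the set of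 forward Cauchy weights of $X$ with $[0,1]$-order $\mathrm{sub}_X$. A map $f:X\to Y$ is left adjoint to $g:Y\to X$ if $Y(f(x),y)=X(x,g(y))$ for all $x,y$. A separated $[0,1]$-ordered set $X$ is a $[0,1]$-domain if the map $\mathsf{y}:X\to\mathcal{D}X$, $x\mapsto X(-,x)$, has a left adjoint $\sup:\mathcal{D}X\to X$ (which sends each forward Cauchy weight to its supremum) and $\sup$ itself has a left adjoint $\mathsf{d}:X\to\mathcal{D}X$. A continuous $[0,1]$-lattice is a complete $[0,1]$-lattice that is a $[0,1]$-domain. A $[0,1]$-approach structure on a set $X$ is a map $\delta:X\times 2^X\to[0,1]$ with: $\delta(x,\{x\})=1$; $\delta(x,\varnothing)=0$; $\delta(x,A\cup B)=\delta(x,A)\vee\delta(x,B)$; $\delta(x,A)\ge\big(\inf_{b\in B}\delta(b,A)\big)\&\delta(x,B)$. A map $f$ between $[0,1]$-approach spaces is continuous if $\delta_X(x,A)\le\delta_Y(f(x),f(A))$ for all $x\in X$, $A\subseteq X$. A subspace on $Y\subseteq X$ is obtained by restricting $\delta$ to $Y\times 2^Y$. A $[0,1]$-approach space $Z$ is injective if every continuous map from a subspace of a $[0,1]$-approach space $X$ to $Z$ extends to a continuous map $X\to Z$. The specialization $[0,1]$-order $\Omega(X)$ of $(X,\delta)$ is $\Omega(\delta)(x,y)=\delta(x,\{y\})$; the space is separated if $\Omega(\delta)$ is separated. A weight $\phi$ of a $[0,1]$-ordered set $X$ is Scott closed if $\mathrm{sub}_X(\lambda,\phi)=\phi(\sup\lambda)$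 for every forward Cauchy weight $\lambda$ of $X$ having a supremum. The Scott $[0,1]$-approach structure of $X$ is $\delta(x,A)=\inf\{\phi(x)\mid\phi\text{ a Scott closed weight of }X,\ \phi(a)=1\text{ for all }a\in A\}$; $\Sigma X$ denotes $X$ with this structure. *)

(* Defs.v *)
From mathcomp Require Import all_boot all_order all_algebra.
From mathcomp Require Import all_classical all_reals all_analysis.
Import Order.TTheory GRing.Theory Num.Theory.
Import numFieldNormedType.Exports.

Set Implicit Arguments.
Unset Strict Implicit.
Unset Printing Implicit Defensive.

Local Open Scope classical_set_scope.
Local Open Scope ring_scope.

Section UnitInterval.
Variable R : realType.
Local Notation I := {i01 R}.
Implicit Types (A : set I) (x : I).

Definition i01_val x : R := x%:num.

(* Inserting 0 in a supremum and 1 in an infimum does not change the value over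
   a nonempty family, and gives the empty family its value in [0,1], whereas
   [sup] and [inf] on [R] are both 0 on the empty set. *)
Definition i01_sup_val A : R := sup (0 |` (i01_val @` A)).
Definition i01_inf_val A : R := inf (1 |` (i01_val @` A)).

Lemma i01_sup_ub A : ubound (0 |` (i01_val @` A)) 1.
Proof. by move=> _ [->|[x _ <-]] //; rewrite /i01_val. Qed.

Lemma i01_inf_lb A : lbound (1 |` (i01_val @` A)) 0.
Proof. by move=> _ [->|[x _ <-]] //; rewrite /i01_val. Qed.

Lemma i01_sup_ge0 A : 0 <= i01_sup_val A.
Proof. by apply: ub_le_sup; [exists 1; exact: i01_sup_ub | left]. Qed.

Lemma i01_sup_le1 A : i01_sup_val A <= 1.
Proof. by apply: ge_sup; [exists 0; left | exact: i01_sup_ub]. Qed.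

Lemma i01_inf_ge0 A : 0 <= i01_inf_val A.
Proof. by apply: lb_le_inf; [exists 1; left | exact: i01_inf_lb]. Qed.

Lemma i01_inf_le1 A : i01_inf_val A <= 1.
Proof. by apply: ge_inf; [exists 0; exact: i01_inf_lb | left]. Qed.

Definition i01_sup A : I := Itv01 (i01_sup_ge0 A) (i01_sup_le1 A).
Definition i01_inf A : I := Itv01 (i01_inf_ge0 A) (i01_inf_le1 A).

Lemma i01_sup_le A x : (i01_sup A <= x) <-> (forall a, A a -> a <= x).
Proof.
split=> [h a Aa|h].
  apply: le_trans h; rewrite -num_le /=.
  by apply: ub_le_sup; [exists 1; exact: i01_sup_ub | right; exists a].
rewrite -num_le /=; apply: ge_sup; first by exists 0; left.
by move=> _ [->|[a Aa <-]] //; rewrite /i01_val num_le; exact: h.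
Qed.

Lemma i01_le_inf A x : (x <= i01_inf A) <-> (forall a, A a -> x <= a).
Proof.
split=> [h a Aa|h].
  apply: (le_trans h); rewrite -num_le /=.
  by apply: ge_inf; [exists 0; exact: i01_inf_lb | right; exists a].
rewrite -num_le /=; apply: lb_le_inf; first by exists 1; left.
by move=> _ [->|[a Aa <-]] //; rewrite /i01_val num_le; exact: h.
Qed.

Lemma i01_le1 x : x <= 1%:i01.
Proof. by rewrite -num_le /=. Qed.

Lemma i01_ge0 x : 0%:i01 <= x.
Proof. by rewrite -num_le /=. Qed.

(* [0,1] with its Euclidean topology, induced by the inclusion into [R]. *)
Definition i01_top : topologicalType := initial_topology i01_val.

End UnitInterval.

Record ctnorm (R : realType) := CTnorm {
  tnorm :> {i01 R} -> {i01 R} -> {i01 R};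
  tnormA : associative tnorm;
  tnormC : commutative tnorm;
  tnorm1 : right_id 1%:i01 tnorm;
  tnorm_le : forall x x' y y' : {i01 R},
    x <= x' -> y <= y' -> tnorm x y <= tnorm x' y';
  tnorm_continuous :
    continuous (fun p : i01_top R * i01_top R => tnorm p.1 p.2 : i01_top R)
}.

Section Tnorm.
Variables (R : realType) (T : ctnorm R).
Local Notation I := {i01 R}.
Implicit Types x y z : I.

Definition residuum x y : I := i01_sup [set z | T x z <= y].

Lemma tnorm0 x : T x 0%:i01 = 0%:i01.
Proof.
apply/le_anti; rewrite i01_ge0 andbT.
apply: (le_trans (tnorm_le T (i01_le1 x) (lexx _))).
by rewrite tnormC tnorm1.
Qed.

Lemma tnorm_residuum x y : T x (residuum x y) <= y.
Proof.
rewrite leNgt; apply/negP => lt_y.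
have cT : continuous (fun z : i01_top R => i01_val (T x z) : R).
  move=> z.
  apply: (@continuous_comp (i01_top R) (i01_top R) R (fun z => T x z) (@i01_val R)).
    apply: (@continuous_comp (i01_top R) (i01_top R * i01_top R)%type (i01_top R)
      (fun z => (x : i01_top R, z)) (fun p => T p.1 p.2 : i01_top R)).
      apply: (@cvg_pair _ _ _ (nbhs z) (nbhs (x : i01_top R)) (nbhs z)).
        exact: (@cvg_cst (i01_top R)).
      exact: cvg_id.
    exact: tnorm_continuous.
  exact: initial_continuous.
pose c := residuum x y.
have : nbhs (c : i01_top R) [set z : i01_top R | i01_val y < i01_val (T x z)].
  apply: (cT c [set t | i01_val y < t]).
  by apply: open_nbhs_nbhs; split => //; exact: open_gt.
rewrite nbhsE => -[U [[V oV VU] Uc]] Usub.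
have : nbhs (i01_val c) V.
  by apply: open_nbhs_nbhs; split => //; move: Uc; rewrite -VU.
move=> /nbhs_ballP[e /= e0 eV].
have [z Sz cz] : exists2 z : I, T x z <= y & i01_val c - e < i01_val z.
  have [s [->|[z Sz <-]]] : exists2 s, (0 |` (@i01_val R @` [set z | T x z <= y])) s
      & i01_val c - e < s.
    apply: sup_adherent => //; split; first by exists 0; left.
    by exists 1; exact: i01_sup_ub.
  - move=> h; exists 0%:i01 => //.
    by rewrite tnorm0 i01_ge0.
  - by move=> h; exists z.
have zc : i01_val z <= i01_val c.
  by rewrite /i01_val num_le; exact: (i01_sup_le _ _).1 (lexx _) _ Sz.
have : [set z : i01_top R | i01_val y < i01_val (T x z)] z.
  apply: Usub; rewrite -VU; apply: eV.
  by rewrite /ball /= ger0_norm ?subr_ge0// ltrBlDr addrC -ltrBlDr.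
by rewrite /= /i01_val num_lt ltNge Sz.
Qed.

Lemma le_residuum x y z : (T x z <= y) <-> (z <= residuum x y).
Proof.
split=> [h|h]; first exact: (i01_sup_le _ _).1 (lexx _) _ h.
exact: le_trans (tnorm_le T (lexx x) h) (tnorm_residuum x y).
Qed.

End Tnorm.

Section Orders.
Variables (R : realType) (T : ctnorm R).
Local Notation I := {i01 R}.

Record i01_order (X : Type) := I01Order {
  i01_hom :> X -> X -> I;
  homxx : forall x, i01_hom x x = 1%:i01;
  hom_trans : forall x y z, T (i01_hom y z) (i01_hom x y) <= i01_hom x z
}.

Definition sub_hom (X : Type) (phi psi : X -> I) : I :=
  i01_inf [set residuum T (phi x) (psi x) | x in setT].

Lemma sub_hom_refl (X : Type) (phi : X -> I) : sub_hom phi phi = 1%:i01.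
Proof.
apply/le_anti; rewrite i01_le1 /=; apply/i01_le_inf => _ [x _ <-].
by apply/le_residuum; rewrite tnorm1.
Qed.

Lemma sub_hom_trans (X : Type) (phi psi chi : X -> I) :
  T (sub_hom psi chi) (sub_hom phi psi) <= sub_hom phi chi.
Proof.
have subE (f g : X -> I) x : T (f x) (sub_hom f g) <= g x.
  by apply/le_residuum; apply: ((i01_le_inf _ _).1 (lexx _)); exists x.
apply/i01_le_inf => _ [x _ <-]; apply: (le_residuum T _ _ _).1.
rewrite (tnormC T (sub_hom psi chi)) (tnormA T (phi x)).
apply: le_trans (subE psi chi x).
by apply: tnorm_le => //; exact: subE.
Qed.

Definition left_adjoint (X Y : Type) (rX : i01_order X) (rY : i01_order Y)
  (f : X -> Y) (g : Y -> X) : Prop :=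
  forall x y, rY (f x) y = rX x (g y).

Section OrderTheory.
Variables (X : Type) (r : i01_order X).

Definition separated_order : Prop :=
  forall x y, r x y = 1%:i01 -> r y x = 1%:i01 -> x = y.

Definition weight (phi : X -> I) : Prop :=
  forall x y, T (phi y) (r x y) <= phi x.

Definition is_supremum (phi : X -> I) (a : X) : Prop :=
  forall y, r a y = sub_hom phi (fun x => r x y).

Definition i01_complete_lattice : Prop :=
  separated_order /\ forall phi, weight phi -> exists a, is_supremum phi a.

Definition directed_set (J : Type) (leJ : J -> J -> Prop) : Prop :=
  [/\ inhabited J, forall i, leJ i i,
      forall i j k, leJ i j -> leJ j k -> leJ i k
    & forall i j, exists2 k, leJ i k & leJ j k].

Definition forward_cauchy_net (J : Type) (leJ : J -> J -> Prop) (u : J -> X) :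
    Prop :=
  i01_sup [set i01_inf [set r (u jl.1) (u jl.2) |
                          jl in [set jl | leJ i jl.1 /\ leJ jl.1 jl.2]]
          | i in setT] = 1%:i01.

Definition net_weight (J : Type) (leJ : J -> J -> Prop) (u : J -> X) (x : X) :
    I :=
  i01_sup [set i01_inf [set r x (u j) | j in [set j | leJ i j]] | i in setT].

Definition forward_cauchy_weight (phi : X -> I) : Prop :=
  weight phi /\
  exists (J : Type) (leJ : J -> J -> Prop) (u : J -> X),
    [/\ directed_set leJ, forward_cauchy_net leJ u
      & forall x, phi x = net_weight leJ u x].

Definition forward_cauchy_weights : Type := {phi : X -> I | forward_cauchy_weight phi}.

Definition fcw_order : i01_order forward_cauchy_weights :=
  @I01Order forward_cauchy_weights (fun phi psi => sub_hom (sval phi) (sval psi))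
    (fun phi => sub_hom_refl (sval phi))
    (fun phi psi chi => sub_hom_trans (sval phi) (sval psi) (sval chi)).

Lemma representable_forward_cauchy (x : X) :
  forward_cauchy_weight (fun z => r z x).
Proof.
split; first by move=> y z; exact: hom_trans.
exists unit, (fun _ _ => True), (fun=> x); split.
- split=> //; exact: (inhabits tt).
- apply/le_anti; rewrite i01_le1 /=.
  apply: ((i01_sup_le _ _).1 (lexx _)); exists tt => //.
  apply/le_anti; rewrite i01_le1 /=.
  by apply/i01_le_inf => _ [_ _ <-]; rewrite homxx.
- move=> z; apply/le_anti/andP; split.
    apply: le_trans ((i01_sup_le _ _).1 (lexx _) _ _); last by exists tt.
    by apply/i01_le_inf => _ [_ _ <-].
  apply/i01_sup_le => _ [i _ <-].
  by apply: ((i01_le_inf _ _).1 (lexx _)); exists tt.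
Qed.

Definition yoneda (x : X) : forward_cauchy_weights := exist _ _ (representable_forward_cauchy x).

Definition i01_domain : Prop :=
  separated_order /\
  exists s : forward_cauchy_weights -> X, left_adjoint fcw_order r s yoneda /\
  exists d : X -> forward_cauchy_weights, left_adjoint r fcw_order d s.

Definition i01_continuous_lattice : Prop := i01_complete_lattice /\ i01_domain.

(* Suprema are unique only up to isomorphism, hence the quantification over
   every supremum [a] of [lambda]. *)
Definition scott_closed (phi : X -> I) : Prop :=
  weight phi /\
  forall lambda a, forward_cauchy_weight lambda -> is_supremum lambda a ->
    sub_hom lambda phi = phi a.

Definition scott_delta (x : X) (A : set X) : I :=
  i01_inf [set phi x | phi in
    [set phi | scott_closed phi /\ forall a, A a -> phi a = 1%:i01]].

End OrderTheory.

Record approach (X : Type) := Approach {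
  approach_delta :> X -> set X -> I;
  delta1 : forall x, approach_delta x [set x] = 1%:i01;
  delta0 : forall x, approach_delta x set0 = 0%:i01;
  deltaU : forall x A B, approach_delta x (A `|` B) =
    Order.max (approach_delta x A) (approach_delta x B);
  delta_ge : forall x A B,
    T (i01_inf [set approach_delta b A | b in B]) (approach_delta x B) <=
    approach_delta x A
}.

Definition approach_continuous (X Y : Type) (dX : approach X) (dY : approach Y)
  (f : X -> Y) : Prop :=
  forall x A, dX x A <= dY (f x) (f @` A).

Section Subspace.
Variables (X : Type) (dX : approach X) (Y : set X).

Let dY (y : {x | Y x}) (B : set {x | Y x}) : I := dX (sval y) (sval @` B).

Lemma subspace_delta1 y : dY y [set y] = 1%:i01.
Proof. by rewrite /dY image_set1 delta1. Qed.

Lemma subspace_delta0 y : dY y set0 = 0%:i01.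
Proof. by rewrite /dY image_set0 delta0. Qed.

Lemma subspace_deltaU y A B : dY y (A `|` B) = Order.max (dY y A) (dY y B).
Proof. by rewrite /dY image_setU deltaU. Qed.

Lemma subspace_delta_ge y A B :
  T (i01_inf [set dY b A | b in B]) (dY y B) <= dY y A.
Proof.
apply: le_trans (delta_ge dX _ _ (sval @` B)).
apply: tnorm_le => //; apply/i01_le_inf => _ [_ [b Bb <-] <-].
by apply: ((i01_le_inf _ _).1 (lexx _)); exists b.
Qed.

Definition subspace_approach : approach {x | Y x} :=
  Approach subspace_delta1 subspace_delta0 subspace_deltaU subspace_delta_ge.

End Subspace.

Definition injective_space (Z : Type) (dZ : approach Z) : Prop :=
  forall (X : Type) (dX : approach X) (Y : set X) (f : {x | Y x} -> Z),
    approach_continuous (subspace_approach dX Y) dZ f ->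
    exists g : X -> Z,
      approach_continuous dX dZ g /\ forall y, g (sval y) = f y.

Section Specialization.
Variables (X : Type) (dX : approach X).

Lemma specialization_trans x y z :
  T (dX y [set z]) (dX x [set y]) <= dX x [set z].
Proof.
apply: le_trans (delta_ge dX x [set z] [set y]); apply: tnorm_le => //.
by apply/i01_le_inf => _ [_ -> <-].
Qed.

Definition specialization : i01_order X :=
  @I01Order X (fun x y => dX x [set y]) (fun x => delta1 dX x)
    specialization_trans.

End Specialization.

End Orders.

(* Main.v *)
Require Import Defs.
From mathcomp Require Import all_boot all_order all_algebra.
From mathcomp Require Import all_classical all_reals all_analysis.
Import Order.TTheory GRing.Theory Num.Theory.
Import numFieldNormedType.Exports.

Set Implicit Arguments.
Unset Strict Implicit.
Unset Printing Implicit Defensive.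

Local Open Scope classical_set_scope.
Local Open Scope ring_scope.

(** Write I for the unit interval and e : X -> I^(set X) for the map sending x
to its distances A |-> delta(x, A).  A power Y = I^J is ordered by
Y(p, q) = inf_k (q_k -> p_k), the reverse of the pointwise order, so that e is
an isometry of [0,1]-ordered sets.  A point b is way above p ([way_above])
when finitely many coordinates of b differ from 1 and each of these is
strictly larger than that of p.  The idea of the proof is to give Y the
explicit closeness
    delta_Y(p, B) = inf (b way above p) sup (q in B) Y(b, q),
for which the points b way above p form a directed net that is as close to p
as possible ([power_delta_way_above]).  Continuity of the t-norm enters through
its right continuity ([tnorm_above]), which makes delta_Y transitive and,
together with the additivity of delta on finite unions, makes e continuous
([power_delta_continuous]); by [power_delta_initial], e is an embedding.

If X is separated and injective, the identity of X, seen on the subspace e(X),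
extends to a continuous retraction g : Y -> X ([injective_retraction]), and all
the structure of X is the image under g of that of Y.
- The supremum of phi is g of the pointwise supremum
  A |-> sub(phi, delta(-, A)) of its image in Y ([retract_supP]).
- Each delta(-, A) is Scott closed ([scott_closed_delta]).  If lambda is the
  weight of a forward Cauchy net u_j, the coordinate A of the pointwise supremum
  is the upper limit of the delta(u_j, A), so every b way above this supremum
  is way above e(u_j) from some index on ([net_eventually_way_above]); thus
  closeness to e(A) passes to the limit in Y, and g carries it to X.
- The left adjoint d of sup sends x to the weight [way_below] of the directed
  net of all g(b) with b way above e(x).  Its supremum is x, because g(e(x)) is
  in the closure of the g(b); and sub(d(x), lambda) = X(x, sup lambda)
  ([sub_hom_way_below]) again because the distances along the net are eventually
  below any bound way above their limits.
- Finally delta is the Scott structure ([delta_scott]).  The weights delta(-, A)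
  are themselves Scott closed, so the Scott closeness is at most delta(x, A).
  Conversely a Scott closed phi is determined by phi(x) = inf_b phi(g(b)), and
  if phi is 1 on A then phi(g(b)) is at least sup (a in A) Y(b, e(a)), hence at
  least delta_Y(e(x), e(A)) = delta(x, A). *)

(** * The unit interval and its residuation *)

Section UnitInterval.
Variable R : realType.
Local Notation I := {i01 R}.
Implicit Types (A : set I) (x y z : I).

Lemma i01_sup_upper A a : A a -> a <= i01_sup A.
Proof. exact: (i01_sup_le A _).1 (lexx _) a. Qed.

Lemma i01_inf_lower A a : A a -> i01_inf A <= a.
Proof. exact: (i01_le_inf A _).1 (lexx _) a. Qed.

Lemma i01_eq1 x : 1%:i01 <= x -> x = 1%:i01.
Proof. by move=> h; apply/le_anti; rewrite i01_le1. Qed.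

Lemma i01_dense x y : x < y -> exists2 z, x < z & z < y.
Proof.
move=> xy; have [xz zy] := midf_lt (xy : x%:num < y%:num).
have z0 : 0 <= (x%:num + y%:num) / 2 by apply: ltW; exact: le_lt_trans xz.
have z1 : (x%:num + y%:num) / 2 <= 1 by apply: ltW; exact: lt_le_trans zy _.
by exists (Itv01 z0 z1).
Qed.

Lemma i01_le_gt x y : (forall z, y < z -> x <= z) -> x <= y.
Proof.
move=> h; rewrite leNgt; apply/negP => /i01_dense[z yz zx].
by move: (h z yz); rewrite leNgt zx.
Qed.

Lemma i01_inf_lt A y : i01_inf A < y -> y <> 1%:i01 -> exists2 a, A a & a < y.
Proof.
move=> Ay y1; apply: contrapT => nA; move: Ay; rewrite ltNge => /negP; apply.
apply/i01_le_inf => a Aa; rewrite leNgt; apply/negP => ay; apply: nA.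
by exists a.
Qed.

(** The way-below relation of the unit interval for the reversed order.  The
value 1, the least element of that order, is way below every point, itself
included. *)
Definition above x y := x < y \/ y = 1%:i01.

Lemma above_le x y : above x y -> x <= y.
Proof. by case=> [/ltW//|->]; exact: i01_le1. Qed.

Lemma le_above_trans x y z : x <= y -> above y z -> above x z.
Proof. by move=> xy [yz|->]; [left; exact: le_lt_trans yz|right]. Qed.

Lemma above_dense x y : above x y -> exists2 z, above x z & above z y.
Proof.
case=> [/i01_dense[z xz zy]|->]; first by exists z; left.
by exists 1%:i01; right.
Qed.

Lemma above_min x y z : above x y -> above x z -> above x (Order.min y z).
Proof.
case=> [xy|->]; last by rewrite min_r ?i01_le1.
case=> [xz|->]; last by rewrite min_l ?i01_le1//; left.
by left; rewrite lt_min xy.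
Qed.

Lemma i01_inf_above A y : above (i01_inf A) y -> A !=set0 ->
  exists2 a, A a & a <= y.
Proof.
move=> Ay [a0 Aa0].
have [->|/eqP y1] := eqVneq y 1%:i01; first by exists a0 => //; exact: i01_le1.
case: Ay => [/i01_inf_lt|//] /(_ y1)[a Aa /ltW ay]; by exists a.
Qed.

Variable T : ctnorm R.

(** Right continuity of the t-norm, in the form of an interpolation.  The
preimage under [T t] of the values below [b] is a neighbourhood of [q], so it
contains a point to the right of [q] unless [q = 1], and then [q' = 1] works. *)
Lemma tnorm_above t q b : above (T t q) b ->
  exists2 q', above q q' & T t q' <= b.
Proof.
case=> [ltb|->]; last by exists 1%:i01; [right | exact: i01_le1].
have cT : continuous (fun z : i01_top R => i01_val (T t z) : R).
  move=> z.
  apply: (@continuous_comp (i01_top R) (i01_top R) R (fun z => T t z)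
    (@i01_val R)).
    apply: (@continuous_comp (i01_top R) (i01_top R * i01_top R)%type (i01_top R)
      (fun z => (t : i01_top R, z)) (fun p => T p.1 p.2 : i01_top R)).
      apply: (@cvg_pair _ _ _ (nbhs z) (nbhs (t : i01_top R)) (nbhs z)).
        exact: (@cvg_cst (i01_top R)).
      exact: cvg_id.
    exact: tnorm_continuous.
  exact: initial_continuous.
have : nbhs (q : i01_top R) [set z : i01_top R | i01_val (T t z) < i01_val b].
  apply: (cT q [set s | s < i01_val b]).
  by apply: open_nbhs_nbhs; split => //; exact: open_lt.
rewrite nbhsE => -[U [[V oV VU] Uq] Usub].
have : nbhs (i01_val q) V.
  by apply: open_nbhs_nbhs; split => //; move: Uq; rewrite -VU.
move=> /nbhs_ballP[e /= e0 eV].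
have [q1|q1] := ltP q 1%:i01; last first.
  exists 1%:i01; first by right.
  by rewrite -(i01_eq1 q1); exact: ltW.
have hlt : q%:num < Order.min 1 (q%:num + e).
  by rewrite lt_min ltrDl e0 andbT.
have [lo hi] := midf_lt hlt.
set m := _ / 2 in lo hi.
have m0 : 0 <= m by apply: ltW; exact: le_lt_trans lo.
move: hi; rewrite lt_min => /andP[/ltW m1 mqe].
exists (Itv01 m0 m1); first by left.
apply: ltW; rewrite -num_lt.
have : U (Itv01 m0 m1 : i01_top R).
  rewrite -VU; apply: eV; rewrite /ball /= /i01_val /=.
  by rewrite ltr0_norm ?subr_lt0// opprB ltrBlDl.
exact: Usub.
Qed.

(** Multiplication is residuated, so it preserves suprema. *)
Lemma tnorm_supl A t y : (forall a, A a -> T a t <= y) -> T (i01_sup A) t <= y.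
Proof.
move=> h; rewrite tnormC; apply/le_residuum/i01_sup_le => a Aa.
by apply/le_residuum; rewrite tnormC; exact: h.
Qed.

Lemma le_sub_hom (X : Type) (phi psi : X -> I) z :
  z <= sub_hom T phi psi <-> forall x : X, T (phi x) z <= psi x.
Proof.
split=> [h x|h].
  apply/le_residuum; apply: le_trans h _; apply: i01_inf_lower; by exists x.
by apply/i01_le_inf => _ [x _ <-]; apply/le_residuum.
Qed.

Lemma sub_hom_app (X : Type) (phi psi : X -> I) (x : X) :
  T (phi x) (sub_hom T phi psi) <= psi x.
Proof. exact: (le_sub_hom phi psi _).1 (lexx _) x. Qed.

Lemma sub_hom_le (X : Type) (phi phi' psi psi' : X -> I) :
  (forall x : X, phi' x <= phi x) -> (forall x : X, psi x <= psi' x) ->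
  sub_hom T phi psi <= sub_hom T phi' psi'.
Proof.
move=> hphi hpsi; apply/le_sub_hom => x; apply: le_trans (hpsi x).
apply: le_trans (sub_hom_app phi psi x); exact: tnorm_le.
Qed.

End UnitInterval.

(** * The closeness space of a power of the unit interval *)

Section Power.
Variables (R : realType) (T : ctnorm R) (J : choiceType).
Local Notation I := {i01 R}.
Implicit Types (p q b c : J -> I) (A B : set (J -> I)).

Definition way_above p b :=
  (forall k, above (p k) (b k)) /\ finite_set [set k | b k != 1%:i01].

Lemma way_above_le p b k : way_above p b -> p k <= b k.
Proof. by move=> [h _]; exact: above_le. Qed.

Lemma way_above_min p b c : way_above p b -> way_above p c ->
  way_above p (fun k => Order.min (b k) (c k)).
Proof.
move=> [pb fb] [pc fc]; split=> [k|]; first exact: above_min.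
have fU : finite_set ([set k | b k != 1%:i01] `|` [set k | c k != 1%:i01]).
  by rewrite finite_setU.
apply: sub_finite_set fU => k /=; rewrite minEle.
by case: ifP => _ ?; [left|right].
Qed.

Lemma way_above_cst1 p : way_above p (fun=> 1%:i01).
Proof.
split=> [k|]; first by right.
by apply: sub_finite_set (finite_set0 _) => k /=; rewrite eqxx.
Qed.

Lemma way_above_dense p b : way_above p b ->
  exists2 c, way_above p c & way_above c b.
Proof.
move=> [pb fb].
have /choice[c cP] : forall k, exists z, [/\ above (p k) z, above z (b k)
    & b k = 1%:i01 -> z = 1%:i01].
  move=> k; have [bk|bk] := eqVneq (b k) 1%:i01.
    by exists 1%:i01; split=> //; [right|rewrite bk; right].
  by have [z ? ?] := above_dense (pb k); exists z; split=> // /eqP; rewrite (negbTE bk).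
exists c; split=> [k|//]; try by have [] := cP k.
apply: sub_finite_set fb => k /=; apply: contraNN => /eqP bk.
by have [_ _ ->] := cP k.
Qed.

Lemma le_way_above_trans p c b :
  (forall k, p k <= c k) -> way_above c b -> way_above p b.
Proof. by move=> pc [cb fb]; split=> // k; exact: le_above_trans (cb k). Qed.

(** The points way above [p] play the role of the basic neighbourhoods of [p]:
[p] is close to [A] when each of them is below some point of [A]. *)
Definition power_delta p A : I :=
  i01_inf [set i01_sup [set sub_hom T q b | q in A] | b in way_above p].

Lemma le_power_delta t p A : t <= power_delta p A <->
  forall b, way_above p b -> t <= i01_sup [set sub_hom T q b | q in A].
Proof.
split=> [h b pb|h]; last by apply/i01_le_inf => _ [b pb <-]; exact: h.
by apply: le_trans h _; apply: i01_inf_lower; exists b.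
Qed.

Lemma power_delta_app p A b : way_above p b ->
  power_delta p A <= i01_sup [set sub_hom T q b | q in A].
Proof. exact: (le_power_delta _ p A).1 (lexx _) b. Qed.

Lemma sub_hom_way_above p q b : way_above p b -> sub_hom T q p <= sub_hom T q b.
Proof. by move=> pb; apply: sub_hom_le => // k; exact: way_above_le. Qed.

Lemma power_delta_point p q : sub_hom T q p <= power_delta p [set q].
Proof.
apply/le_power_delta => b pb; apply: le_trans (sub_hom_way_above q pb) _.
by apply: i01_sup_upper; exists q.
Qed.

Lemma power_delta_way_above p : power_delta p (way_above p) = 1%:i01.
Proof.
apply: i01_eq1; apply/le_power_delta => b pb.
by apply: i01_sup_upper; exists b => //; exact: sub_hom_refl.
Qed.

Lemma power_delta1 p : power_delta p [set p] = 1%:i01.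
Proof. by apply: i01_eq1; rewrite -(sub_hom_refl T p); exact: power_delta_point. Qed.

Lemma power_delta0 p : power_delta p set0 = 0%:i01.
Proof.
apply/le_anti; rewrite i01_ge0 andbT.
apply: le_trans (power_delta_app _ (way_above_cst1 p)) _.
by apply/i01_sup_le => a [q].
Qed.

Lemma power_delta_le p A B : A `<=` B -> power_delta p A <= power_delta p B.
Proof.
move=> AB; apply/le_power_delta => b pb; apply: le_trans (power_delta_app A pb) _.
apply/i01_sup_le => _ [q Aq <-]; apply: i01_sup_upper; exists q => //; exact: AB.
Qed.

(** The infimum over [way_above p] commutes with binary maxima because
[way_above p] is directed, by [way_above_min]. *)
Lemma power_deltaU p A B :
  power_delta p (A `|` B) = Order.max (power_delta p A) (power_delta p B).
Proof.
apply/le_anti; rewrite ge_max !power_delta_le ?andbT;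
  [|exact: subsetUr|exact: subsetUl].
rewrite leNgt gt_max; apply/negP => /andP[hA hB].
have wit C : power_delta p C < power_delta p (A `|` B) ->
    exists2 b, way_above p b &
      i01_sup [set sub_hom T q b | q in C] < power_delta p (A `|` B).
  move=> hC; apply: contrapT => nb; move: hC; rewrite ltNge => /negP; apply.
  apply/le_power_delta => b pb; rewrite leNgt; apply/negP => ?; apply: nb; by exists b.
have [b pb bA] := wit _ hA; have [c pc cB] := wit _ hB.
have pm := way_above_min pb pc.
have := power_delta_app (A `|` B) pm; rewrite leNgt => /negP; apply.
suff : i01_sup [set sub_hom T q (fun k => Order.min (b k) (c k)) |
                  q in A `|` B] <=
       Order.max (i01_sup [set sub_hom T q b | q in A])
                 (i01_sup [set sub_hom T q c | q in B]).
  by move=> /le_lt_trans; apply; rewrite gt_max bA.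
apply/i01_sup_le => _ [q ABq <-]; rewrite le_max; apply/orP.
case: ABq => Cq; [left|right].
  apply: (@le_trans _ _ (sub_hom T q b)); last by apply: i01_sup_upper; exists q.
  by apply: sub_hom_le => // k; rewrite ge_min lexx.
apply: (@le_trans _ _ (sub_hom T q c)); last by apply: i01_sup_upper; exists q.
by apply: sub_hom_le => // k; rewrite ge_min lexx orbT.
Qed.

(** The degree [t] to which [c] lies below [q] carries over to some point way
above [q], once [c] is relaxed to [b]: coordinatewise, [t] times [q k] is at
most [c k], and right continuity moves [q k] up while the product stays at most
[b k]. *)
Lemma way_above_sub_hom t q c b : t <= sub_hom T q c -> way_above c b ->
  exists2 b', way_above q b' & t <= sub_hom T b' b.
Proof.
move=> tqc [cb fb].
have /choice[b' b'P] : forall k, exists z, [/\ above (q k) z, T z t <= b k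
    & b k = 1%:i01 -> z = 1%:i01].
  move=> k; have [bk|bk] := eqVneq (b k) 1%:i01.
    by exists 1%:i01; split=> //; [right|rewrite bk i01_le1].
  have h : above (T t (q k)) (b k).
    by apply: le_above_trans (cb k); rewrite tnormC; exact: (le_sub_hom T q c t).1 tqc k.
  have [z ? tz] := tnorm_above h.
  by exists z; split=> //; [rewrite tnormC | move=> /eqP; rewrite (negbTE bk)].
exists b'; last by apply/le_sub_hom => k; have [] := b'P k.
split=> [k|]; first by have [] := b'P k.
apply: sub_finite_set fb => k /=; apply: contraNN => /eqP bk.
by have [_ _ ->] := b'P k.
Qed.

(** Transitivity of closeness.  Interpolate [c] between [p] and [b]; if [q] in
[B] is above [c] to some degree, [way_above_sub_hom] yields a [b'] way above [q]
which is above [b] to that degree, and [q] being close to [A] puts a point of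
[A] above [b']. *)
Lemma power_delta_ge p A B :
  T (i01_inf [set power_delta b A | b in B]) (power_delta p B) <= power_delta p A.
Proof.
set w := i01_inf _.
apply/le_power_delta => b pb; have [c pc cb] := way_above_dense pb.
rewrite tnormC.
apply: le_trans (tnorm_le T (power_delta_app B pc) (lexx w)) _.
apply: tnorm_supl => _ [q Bq <-].
have [b' qb' tb'] := way_above_sub_hom (lexx (sub_hom T q c)) cb.
have wb' : w <= i01_sup [set sub_hom T a b' | a in A].
  apply: le_trans (power_delta_app A qb'); apply: i01_inf_lower; by exists q.
rewrite tnormC; apply: le_trans (tnorm_le T wb' tb') _.
apply: tnorm_supl => _ [a Aa <-].
rewrite tnormC; apply: le_trans (sub_hom_trans T a b' b) _.
by apply: i01_sup_upper; exists a.
Qed.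

Definition power_approach : approach T (J -> I) :=
  Approach power_delta1 power_delta0 power_deltaU power_delta_ge.

End Power.

(** * Suprema and forward Cauchy weights *)

Section Order.
Variables (R : realType) (T : ctnorm R) (X : Type) (r : i01_order T X).
Local Notation I := {i01 R}.
Implicit Types (x y a : X) (phi lambda : X -> I).

Lemma supremum_upper phi a x : is_supremum r phi a -> phi x <= r x a.
Proof.
move=> /(_ a); rewrite homxx => ha.
by have := sub_hom_app T phi (fun x => r x a) x; rewrite -ha tnorm1.
Qed.

Lemma supremum_unique phi a b : separated_order r ->
  is_supremum r phi a -> is_supremum r phi b -> a = b.
Proof.
move=> sep ha hb; apply: sep.
  by rewrite ha -hb homxx.
by rewrite hb -ha homxx.
Qed.

Section Directed.
Variables (J : Type) (leJ : J -> J -> Prop) (u : J -> X).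
Hypotheses (dirJ : directed_set leJ)
  (monu : forall i j, leJ i j -> r (u i) (u j) = 1%:i01).

Definition directed_weight x : I := i01_sup [set r x (u j) | j in setT].

(** A net that increases in the underlying order is forward Cauchy with all
tail infima equal to 1, and its weight is the union of the representables. *)
Lemma directed_forward_cauchy : forward_cauchy_weight r directed_weight.
Proof.
have [[j0] refl _ _] := dirJ.
split=> [x y|].
  apply: tnorm_supl => _ [j _ <-]; apply: le_trans (hom_trans r x y (u j)) _.
  by apply: i01_sup_upper; exists j.
exists J, leJ, u; split=> //.
  apply: i01_eq1; apply: i01_sup_upper; exists j0 => //.
  by apply/i01_eq1/i01_le_inf => _ [[j l] [_ /= /monu ->] <-].
move=> x; apply/le_anti/andP; split; apply/i01_sup_le => _ [j _ <-].
  apply: (@le_trans _ _ (i01_inf [set r x (u l) | l in [set l | leJ j l]])).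
    apply/i01_le_inf => _ [l /= jl <-].
    apply: le_trans (hom_trans r x (u j) (u l)).
    by rewrite monu// tnormC tnorm1.
  by apply: i01_sup_upper; exists j.
apply: (@le_trans _ _ (r x (u j))); first by apply: i01_inf_lower; exists j => //=.
by apply: i01_sup_upper; exists j.
Qed.

(** The Yoneda lemma, applied to each representable in the union. *)
Lemma le_sub_hom_directed t phi : weight r phi ->
  t <= sub_hom T directed_weight phi <-> forall j, t <= phi (u j).
Proof.
move=> wphi; split=> [/le_sub_hom h j|h].
  apply: le_trans (h (u j)).
  rewrite -[leLHS](tnorm1 T) tnormC; apply: tnorm_le => //.
  by rewrite -(homxx r (u j)); apply: i01_sup_upper; exists j.
apply/le_sub_hom => x; apply: tnorm_supl => _ [j _ <-].
by rewrite tnormC; apply: le_trans (wphi x (u j)); exact: tnorm_le.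
Qed.

End Directed.

(** A weight reflects to the limit whatever it attains cofinally along a net:
[net_weight r leJ u x] is the degree to which [x] is eventually below [u]. *)
Lemma net_weight_cofinal (J : Type) (leJ : J -> J -> Prop) (u : J -> X)
  psi x m :
  weight r psi -> (forall i, exists2 j, leJ i j & m <= psi (u j)) ->
  T (net_weight r leJ u x) m <= psi x.
Proof.
move=> wpsi h; apply: tnorm_supl => _ [i _ <-]; have [j ij mj] := h i.
rewrite tnormC; apply: le_trans (wpsi x (u j)); apply: tnorm_le => //.
by apply: i01_inf_lower; exists j.
Qed.

(** Together with [net_eventually_le] this says that [sub_hom] of the weight of
a forward Cauchy net into [psi] is the upper limit of [psi] along the net.  The
Cauchy condition enters here: the weight of the net takes values arbitrarily
close to 1 at late points of the net itself. *)
Lemma sub_hom_net_eventually (J : Type) (leJ : J -> J -> Prop) (u : J -> X)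
  psi v :
  directed_set leJ -> forward_cauchy_net r leJ u ->
  (exists i, forall j, leJ i j -> psi (u j) <= v) ->
  sub_hom T (net_weight r leJ u) psi <= v.
Proof.
move=> [_ refl tr dir] fc [i0 hi0].
rewrite -[leLHS](tnorm1 T) -fc tnormC; apply: tnorm_supl => _ [i _ <-].
have [j ij i0j] := dir i i0.
apply: le_trans (hi0 j i0j).
apply: le_trans (sub_hom_app T _ psi (u j)).
apply: tnorm_le => //.
apply: (@le_trans _ _ (i01_inf [set r (u j) (u l) | l in [set l | leJ j l]])).
  apply/i01_le_inf => _ [l /= jl <-]; apply: i01_inf_lower; by exists (j, l).
by apply: i01_sup_upper; exists j.
Qed.

Lemma net_eventually_le (J : Type) (leJ : J -> J -> Prop) (u : J -> X) psi v :
  directed_set leJ -> weight r psi ->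
  above (sub_hom T (net_weight r leJ u) psi) v ->
  exists i, forall j, leJ i j -> psi (u j) <= v.
Proof.
move=> [[j0] _ _ _] wpsi [hv|->]; last by exists j0 => j _; exact: i01_le1.
apply: contrapT => nev; move: hv; rewrite ltNge => /negP; apply.
apply/le_sub_hom => x; apply: net_weight_cofinal => // i.
apply: contrapT => ni; apply: nev; exists i => j ij; rewrite leNgt.
by apply/negP => /ltW vj; apply: ni; exists j.
Qed.

(** Finitely many coordinates of [b] differ from 1, so the indices given by
[net_eventually_le] for these coordinates have a common bound. *)
Lemma net_eventually_way_above (K : choiceType) (J : Type)
  (leJ : J -> J -> Prop) (u : J -> X) (psi : K -> X -> I) (b : K -> I) :
  directed_set leJ -> (forall k, weight r (psi k)) ->
  way_above (fun k => sub_hom T (net_weight r leJ u) (psi k)) b ->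
  exists i, forall j, leJ i j -> forall k, psi k (u j) <= b k.
Proof.
move=> dirJ wpsi [hb /finite_seqP[s sE]].
have [[j0] refl tr dir] := dirJ.
have [i hi] : exists i, forall j, leJ i j ->
    forall k, k \in s -> psi k (u j) <= b k.
  elim: s {sE} => [|k s [i hi]]; first by exists j0.
  have [i' hi'] := net_eventually_le dirJ (wpsi k) (hb k).
  have [l il i'l] := dir i i'; exists l => j lj k'.
  rewrite inE => /orP[/eqP->|]; [apply: hi'|apply: hi]; exact: tr lj.
exists i => j ij k; have [->|bk] := eqVneq (b k) 1%:i01; first exact: i01_le1.
by apply: hi ij _ _; have : [set k | b k != 1%:i01] k by []; rewrite sE.
Qed.

End Order.

(** * Injective approach spaces *)

Section Approach.
Variables (R : realType) (T : ctnorm R) (X : Type) (dX : approach T X).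
Local Notation I := {i01 R}.
Local Notation r := (specialization dX).
Local Notation Y := (power_approach T (set X)).
Implicit Types (x y : X) (A : set X) (p q b : set X -> I).

Lemma weight_delta A : weight r (fun x => dX x A).
Proof.
move=> x y; apply: le_trans (delta_ge dX x A [set y]); apply: tnorm_le => //.
by apply/i01_le_inf => _ [_ -> <-].
Qed.

Lemma delta_le x A B : A `<=` B -> dX x A <= dX x B.
Proof. by move=> /setUidPr <-; rewrite deltaU le_max lexx. Qed.

Lemma delta_mem a A : A a -> dX a A = 1%:i01.
Proof.
by move=> Aa; apply: i01_eq1; rewrite -(delta1 dX a); apply: delta_le => _ ->.
Qed.

Lemma delta_bigcup_lt (K : choiceType) (F : set K) (C : K -> set X) x v :
  finite_set F -> 0%:i01 < v -> (forall k, F k -> dX x (C k) < v) ->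
  dX x (\bigcup_(k in F) C k) < v.
Proof.
move=> /finite_seqP[s ->] v0; elim: s => [|k s IHs] h.
  by rewrite set_nil bigcup_set0 delta0.
have hs : dX x (\bigcup_(l in [set` s]) C l) < v.
  by apply: IHs => l ls; apply: h; rewrite /= inE ls orbT.
have hk : dX x (C k) < v by apply: h; rewrite /= inE eqxx.
apply: (@le_lt_trans _ _ (dX x (C k `|` \bigcup_(l in [set` s]) C l))).
  apply: delta_le => y [l /=]; rewrite inE => /orP[/eqP->|ls Cy]; first by left.
  by right; exists l.
by rewrite deltaU gt_max hk.
Qed.

(** The map [dX] into the power indexed by the subsets of [X] is an isometry
for the specialization orders; the coordinate [[set y]] alone suffices. *)
Lemma sub_hom_delta x y : sub_hom T (dX y) (dX x) = dX x [set y].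
Proof.
apply/le_anti/andP; split; last by apply/le_sub_hom => A; exact: weight_delta.
have := sub_hom_app T (dX y) (dX x) [set y].
by rewrite delta1 tnormC tnorm1.
Qed.

(** Test against the points way above [dX x] that restrict only the coordinate
[A] itself, where all points of [dX @` A] have value 1. *)
Lemma power_delta_initial x A : power_delta T (dX x) (dX @` A) <= dX x A.
Proof.
apply: i01_le_gt => v xv.
pose (b := fun B : set X => if B == A then v else 1%:i01 : I).
have xb : way_above (dX x) b.
  split=> [B|]; first by rewrite /b; case: eqP => [->|_]; [left|right].
  apply: sub_finite_set (finite_set1 A) => B /=; rewrite /b.
  by case: (eqVneq B A) => // _; rewrite eqxx.
apply: le_trans (power_delta_app _ _ xb) _.
apply/i01_sup_le => _ [_ [a Aa <-] <-].
have := sub_hom_app T (dX a) b A; rewrite /b eqxx.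
by rewrite delta_mem// tnormC tnorm1.
Qed.

(** If [b] way above [dX x] violated the bound, each point of [A] would fail it
in one of the finitely many coordinates restricted by [b], so the sets [C k]
below would cover [A].  As closeness is additive, some [C k] is as close to [x]
as [A] is.  Transitivity then puts [t] times the infimum of the coordinate [k]
over [C k] strictly below [b k], and right continuity finds a point of [C k]
that satisfies the bound, which [C k] excludes. *)
Lemma power_delta_continuous x A : dX x A <= power_delta T (dX x) (dX @` A).
Proof.
apply/le_power_delta => b [xb fb]; rewrite leNgt; apply/negP.
set v := i01_sup _; set t := dX x A => vt.
have t0 : 0%:i01 < t by apply: le_lt_trans vt; exact: i01_ge0.
pose C k := [set a | A a /\ ~ T (dX a k) t <= b k].
have AC : A `<=` \bigcup_(k in [set k | b k != 1%:i01]) C k.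
  move=> a Aa; apply: contrapT => nC; move: vt; rewrite ltNge => /negP; apply.
  apply: (@le_trans _ _ (sub_hom T (dX a) b)); last first.
    by apply: i01_sup_upper; exists (dX a) => //; exists a.
  apply/le_sub_hom => k; apply: contrapT => nk; apply: nC; exists k => //=.
  by apply/eqP => bk; apply: nk; rewrite bk; exact: i01_le1.
suff : t < t by rewrite ltxx.
apply: le_lt_trans (delta_le x AC) _.
apply: delta_bigcup_lt => // k _; rewrite ltNge; apply/negP => tk.
have [a Ca] : C k !=set0.
  apply: contrapT => /set0P/negP/negPn/eqP Ck0.
  by move: tk; rewrite Ck0 delta0 leNgt t0.
have hx : above (T t (i01_inf [set dX a k | a in C k])) (b k).
  apply: le_above_trans (xb k); apply: le_trans (delta_ge dX x k (C k)).
  by rewrite tnormC; exact: tnorm_le.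
have [q hq tq] := tnorm_above hx.
have [_ [a' Ca' <-] a'q] :=
  i01_inf_above hq (ex_intro _ _ (ex_intro2 _ _ a Ca erefl)).
apply: Ca'.2; apply: le_trans tq; rewrite tnormC; exact: tnorm_le.
Qed.

(** By [power_delta_initial] the inverse of [dX] is continuous on the image of
[dX], so injectivity extends it to the whole power. *)
Lemma injective_retraction : separated_order r -> injective_space dX ->
  exists2 g : (set X -> I) -> X,
    approach_continuous Y dX g & forall x, g (dX x) = x.
Proof.
move=> sep inj.
have /choice[f fE] : forall p : {p | range dX p}, exists x, dX x = sval p.
  by move=> [p /= [x _ xp]]; exists x.
have [|g [gc gE]] := inj _ Y (range dX) f.
  move=> p A /=; rewrite -fE.
  have -> : sval @` A = dX @` (f @` A).
    by rewrite image_comp; apply: eq_imagel => q _ /=; rewrite fE.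
  exact: power_delta_initial.
exists g => // x.
have xr : range dX (dX x) by exists x.
rewrite (gE (exist _ _ xr)).
have E := fE (exist _ _ xr); rewrite /= in E.
by apply: sep; rewrite /= -sub_hom_delta E sub_hom_refl.
Qed.

(** * Spaces that are retracts of a power *)

Section Retract.
Variable g : (set X -> I) -> X.
Hypotheses (gc : approach_continuous Y dX g) (gK : forall x, g (dX x) = x).

(** Continuous maps preserve the specialization order. *)
Lemma retraction_hom p q : sub_hom T q p <= r (g p) (g q).
Proof.
apply: le_trans (power_delta_point T p q) _.
by have := gc p [set q]; rewrite image_set1.
Qed.

Definition retract_sup (phi : X -> I) : X :=
  g (fun A => sub_hom T phi (fun x => dX x A)).

(** In any retract of an order with suprema, the supremum is the image of the
supremum upstairs; here that supremum is computed coordinatewise. *)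
Lemma retract_supP phi : is_supremum r phi (retract_sup phi).
Proof.
pose a A := sub_hom T phi (fun x => dX x A).
rewrite -[retract_sup phi]/(g a) => y; apply/le_anti/andP; split.
  apply/le_sub_hom => x; rewrite tnormC.
  apply: le_trans (hom_trans r x (g a) y); apply: tnorm_le => //.
  rewrite -[in leRHS](gK x); apply: le_trans (retraction_hom _ _).
  apply/le_sub_hom => A; rewrite tnormC.
  exact: sub_hom_app.
rewrite -[in leRHS](gK y); apply: le_trans (retraction_hom _ _).
apply/le_sub_hom => A; apply/le_sub_hom => x.
rewrite tnormA (tnormC T (phi x)) -tnormA.
apply: le_trans (weight_delta A x y); apply: tnorm_le => //.
exact: (sub_hom_app T phi (fun x => r x y)).
Qed.

Hypothesis sep : separated_order r.

(** The upper bound is proved in the power.  The supremum is [g m] for the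
coordinatewise supremum [m], and any [b] way above [m] is way above [dX (u j)]
for late [j]; so the closeness of [m] to the image of [A] is at least the upper
limit of the [dX (u j) A], and [g] does not decrease closeness. *)
Lemma scott_closed_delta A : scott_closed r (fun x => dX x A).
Proof.
split; first exact: weight_delta.
move=> lambda a fl supa; apply/le_anti/andP; split; last first.
  apply/le_sub_hom => x; rewrite tnormC.
  apply: le_trans (weight_delta A x a); apply: tnorm_le => //.
  exact: supremum_upper supa.
rewrite (supremum_unique sep supa (retract_supP lambda)).
have [_ [J [leJ [u [dirJ fc lE]]]]] := fl.
have {lE}-> : lambda = net_weight r leJ u by apply/funext.
set m := fun B => sub_hom T (net_weight r leJ u) (fun x => dX x B).
have -> : dX (retract_sup (net_weight r leJ u)) A = dX (g m) (g @` (dX @` A)).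
  rewrite image_comp (_ : _ @` A = A)//.
  by under eq_imagel do rewrite /= gK; rewrite image_id.
apply: le_trans (gc _ _).
apply/le_power_delta => b mb; have [c mc cb] := way_above_dense mb.
apply: (sub_hom_net_eventually dirJ fc).
have [i hi] := net_eventually_way_above dirJ weight_delta mc.
exists i => j ij; apply: le_trans (power_delta_continuous _ _) _.
apply: power_delta_app; exact: le_way_above_trans (hi j ij) cb.
Qed.

(** The analogue of the ideal of all infima of neighbourhoods of [x] in a
continuous lattice. *)
Definition way_below (x : X) : X -> I :=
  directed_weight r (fun b : {b | way_above (dX x) b} => g (sval b)).

Lemma way_above_directed x :
  directed_set (fun b c : {b | way_above (dX x) b} =>
                  forall k, sval c k <= sval b k).
Proof.
split=> //.
- exact: (inhabits (exist _ _ (way_above_cst1 (dX x)))).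
- by move=> b c d bc cd k; exact: le_trans (cd k) (bc k).
- move=> [b xb] [c xc]; exists (exist _ _ (way_above_min xb xc)) => k /=;
    by rewrite ge_min lexx ?orbT.
Qed.

Lemma retraction_antitone b c :
  (forall k, c k <= b k) -> r (g b) (g c) = 1%:i01.
Proof.
move=> cb; apply: i01_eq1; apply: le_trans (retraction_hom b c).
by rewrite -(sub_hom_refl T c); exact: sub_hom_le.
Qed.

Lemma forward_cauchy_way_below x : forward_cauchy_weight r (way_below x).
Proof.
apply: directed_forward_cauchy (way_above_directed x) _ => b c.
exact: retraction_antitone.
Qed.

Lemma le_sub_hom_way_below t x phi : weight r phi ->
  t <= sub_hom T (way_below x) phi <->
  forall b, way_above (dX x) b -> t <= phi (g b).
Proof.
move=> wphi; rewrite le_sub_hom_directed//.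
by split=> [h b xb|h [b xb]]; [exact: (h (exist _ _ xb))|exact: h].
Qed.

(** That [x] is a least upper bound is a closure statement: [x] is in the
closure of the points [g b], since [dX x] is in the closure of the points [b]. *)
Lemma way_below_supremum x : is_supremum r (way_below x) x.
Proof.
move=> y; apply/le_anti/andP; split.
  apply/le_sub_hom_way_below => [|b xb]; first exact: weight_delta.
  apply: le_trans (hom_trans r (g b) x y).
  have bx : r (g b) (g (dX x)) = 1%:i01.
    by apply: retraction_antitone => k; exact: way_above_le.
  by rewrite gK in bx; rewrite bx tnorm1.
apply: le_trans (delta_ge dX x [set y] (g @` way_above (dX x))).
rewrite -[leLHS](tnorm1 T); apply: tnorm_le.
  apply/i01_le_inf => _ [_ [b xb <-] <-].
  exact: (le_sub_hom_way_below _ _ (weight_delta [set y])).1 (lexx _) b xb.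
rewrite -(power_delta_way_above T (dX x)).
by apply: le_trans (gc _ _) _; rewrite gK.
Qed.

(** This is the adjunction between [way_below] and suprema.  For the bound from
below, the degree of [x] below [c] gives [b'] way above [dX c] whose
degree below [b] is at least as large; the coordinates of [dX c] are upper
limits along the net, so the net is eventually bounded by [b']. *)
Lemma sub_hom_way_below x lambda c : forward_cauchy_weight r lambda ->
  is_supremum r lambda c -> sub_hom T (way_below x) lambda = r x c.
Proof.
move=> fl supc; have [wl [J [leJ [u [dirJ fc lE]]]]] := fl.
apply/le_anti/andP; split.
  rewrite way_below_supremum; apply: sub_hom_le => // z; exact: supremum_upper.
apply/le_sub_hom_way_below => // b xb.
have /way_above_sub_hom/(_ xb)[b' cb' tb'] : r x c <= sub_hom T (dX c) (dX x).
  by rewrite sub_hom_delta.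
have [i hi] : exists i, forall j, leJ i j -> forall A, dX (u j) A <= b' A.
  apply: (net_eventually_way_above dirJ weight_delta).
  apply: le_way_above_trans cb' => A.
  have [_ /(_ _ _ fl supc) <-] := scott_closed_delta A.
  by have <- : lambda = net_weight r leJ u by apply/funext.
rewrite lE; apply: le_trans (_ : _ <= i01_inf _) (i01_sup_upper _); last by exists i.
apply/i01_le_inf => _ [j /= ij <-]; rewrite -(gK (u j)).
apply: le_trans tb' _; apply: le_trans (retraction_hom _ _).
by apply: sub_hom_le => //; exact: hi.
Qed.

(** A Scott closed [phi] satisfies [phi x = inf_b phi (g b)], because [x] is the
supremum of [way_below x]; and [phi (g b)] bounds the degree to which [g b] is
below a point where [phi] is 1. *)
Lemma delta_scott x A : dX x A = scott_delta r x A.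
Proof.
apply/le_anti/andP; split; last first.
  apply: i01_inf_lower; exists (fun x => dX x A) => //; split.
    exact: scott_closed_delta.
  by move=> a Aa /=; apply: delta_mem.
apply/i01_le_inf => _ [phi [[wphi sphi] phiA] <-].
rewrite -(sphi _ _ (forward_cauchy_way_below x) (way_below_supremum x)).
apply/le_sub_hom_way_below => // b xb.
apply: le_trans (power_delta_continuous x A) _.
apply: le_trans (power_delta_app _ _ xb) _.
apply/i01_sup_le => _ [_ [a Aa <-] <-].
apply: le_trans (retraction_hom _ _) _; rewrite gK.
by have := wphi (g b) a; rewrite phiA// tnormC tnorm1.
Qed.

Lemma retract_continuous_lattice : i01_continuous_lattice r.
Proof.
split; first by split=> // phi _; exists (retract_sup phi); exact: retract_supP.
split=> //; exists (fun lambda => retract_sup (sval lambda)); split.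
  by move=> lambda y; exact: retract_supP.
exists (fun x => exist _ _ (forward_cauchy_way_below x)) => x lambda.
apply: sub_hom_way_below; [exact: (svalP lambda)|exact: retract_supP].
Qed.

End Retract.

End Approach.

Theorem theorem6p10 (R : realType) (T : ctnorm R) (X : Type)
    (dX : approach T X) :
  separated_order (specialization dX) -> injective_space dX ->
  i01_continuous_lattice (specialization dX) /\
  (forall (x : X) (A : set X), dX x A = scott_delta (specialization dX) x A).
Proof.
move=> sep inj; have [g gc gK] := injective_retraction sep inj.
split; first exact: retract_continuous_lattice gc gK sep.
exact: delta_scott gc gK sep.
Qed.
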